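(* Let $E$ be a Banach space, let $0\le S<T$, let $U(s,t)$, $S\le s\le t\le T$, be a backward propagator on $E$ with left generators $A_t$, and let $Q_{t_1,t_2}$, $S\le t_1\le t_2\le T$, be a two-parameter family of (linear) contractions $E\to E$. Assume: 1) The subset $\bigcap_{t\in[S,T]}D(A_t)$ is dense in $E$. 2) There exists a Banach space $Y$, dense in $E$, such that $Y\subset\bigcap_{t\in[S,T]}D(A_t)$ and $U(s,t)Y\subset Y$ for all $s,t\in[S,T]$, $s<t$, and, moreover, there exists a constant $\gamma>0$ such that the norm of $Y$ satisfies $\|x\|_Y\ge\gamma\bigl[\|x\|_E+\sup_{\tau\in[S,T]}\|A_\tau x\|_E\bigr]$ for all $x\in Y$. 3) For every $x\in Y$ and $t\in[S,T]$, the function $[S,t]\to Y$, $\tau\mapsto U(\tau,t)x$, is continuous. 4) For every $x\in Y$, the function $[S,T]\to E$, $t\mapsto A_tx$, is continuous. 5) For all $x\in Y$ there exists the limit, uniform in $t$, $$\lim_{h\downarrow0}\frac{Q_{t-h,t}x-x}{h}=A_tx .$$ Then, for any subinterval $[s,t]\subset[S,T]$, for any sequence of partitions $\{s=t_0<t_1<\cdots<t_n=t\}$ such that $\max_j|t_j-t_{j-1}|\to0$ as $n\to\infty$, and for all $x\in E$, $$Q_{t_0,t_1}Q_{t_1,t_2}\cdots Q_{t_{n-1},t_n}x\to U(s,t)x\quad\text{in }E,\qquad n\to\infty .$$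
   Context: $\mathcal L(E)$ is the space of bounded linear operators $E\to E$. A two-parameter family $\{U(s,t)\in\mathcal L(E): S\le s\le t\le T\}$ is a backward propagator on $E$ if $U(s,t)=U(s,\tau)U(\tau,t)$ and $U(s,s)=I$ for all $S\le s\le\tau\le t\le T$. Its left generator at $t$ is the operator $A_tx=\lim_{h\downarrow0}\frac{U(t-h,t)x-x}{h}$ with domain $D(A_t)$ consisting of those $x\in E$ for which this limit (in the norm of $E$) exists. The difference quotients involving $U(t-h,t)$ and $Q_{t-h,t}$ are considered for $t\in(S,T]$ and $h>0$ with $t-h\ge S$; at the endpoint $t=S$, where no such quotient is available, $A_S$ is a linear operator on $E$ with domain $D(A_S)$ given as part of the family $(A_t)_{t\in[S,T]}$ and entering only through the assumptions. A contraction is a bounded linear operator of norm at most $1$. $Y$ is a linear subspace of $E$, dense in $E$, equipped with its own norm $\|\cdot\|_Y$ under which it is a Banach space. *)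

(* Defs.v *)
From HB Require Import structures.
From mathcomp Require Import all_boot all_order all_algebra.
From mathcomp Require Import all_classical all_reals all_analysis.

Set Implicit Arguments.
Unset Strict Implicit.
Unset Printing Implicit Defensive.

Import Order.TTheory GRing.Theory Num.Theory.
Import numFieldNormedType.Exports.

Local Open Scope classical_set_scope.
Local Open Scope ring_scope.

Section Defs.
Variables (R : realType) (E : completeNormedModType R).

Definition bounded_op (f : E -> E) : Prop :=
  exists M : R, forall x, `|f x| <= M * `|x|.

Definition contractive (f : E -> E) : Prop := forall x, `|f x| <= `|x|.

(* Two-parameter families are total functions of (s, t); only their values on
   the simplex S <= s <= t <= T are constrained or used. *)
Definition backward_propagator (S T : R) (U : R -> R -> {linear E -> E}) :=
  [/\ forall s t, S <= s -> s <= t -> t <= T -> bounded_op (U s t),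
      forall s, S <= s -> s <= T -> forall x, U s s x = x &
      forall s tau t, S <= s -> s <= tau -> tau <= t -> t <= T ->
        forall x, U s t x = U s tau (U tau t x)].

Definition left_quotient (V : R -> R -> {linear E -> E}) (t : R) (x : E)
    (h : R) : E := h^-1 *: (V (t - h) t x - x).

(* An unbounded operator is a domain D together with a function A : E -> E
   whose values outside D are irrelevant. *)
Definition linear_on (D : set E) (A : E -> E) : Prop :=
  D 0 /\ forall (a : R) x y, D x -> D y ->
    D (a *: x + y) /\ A (a *: x + y) = a *: A x + A y.

Definition is_left_generator (U : R -> R -> {linear E -> E}) (t : R)
    (D : set E) (A : E -> E) : Prop :=
  D = [set x | cvg (left_quotient U t x h @[h --> 0^'+])] /\
  forall x, D x -> left_quotient U t x h @[h --> 0^'+] --> A x.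

(* At t = S no quotient U (t - h) t with h > 0 is available: there the operator
   is a given linear operator with a given domain. *)
Definition left_generators (S T : R) (U : R -> R -> {linear E -> E})
    (D : R -> set E) (A : R -> E -> E) : Prop :=
  linear_on (D S) (A S) /\
  forall t, S < t -> t <= T -> is_left_generator U t (D t) (A t).

(* A linear subspace of E that is a Banach space for a norm of its own is
   represented by that Banach space Y together with its (injective, linear)
   inclusion j : Y -> E; the subspace itself is [range j].
   [restr j f] is the map f, seen as a map from Y to Y; it is meaningful as
   soon as f maps [range j] into itself. *)
Definition restr (Y : completeNormedModType R) (j : Y -> E) (f : E -> E)
    (y : Y) : Y := get [set z | j z = f (j y)].

(* A partition a = t_0 < t_1 < ... < t_n = b is given, as in [itv_partition],
   by a and the sequence p = [:: t_1; ...; t_n]. *)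
Definition mesh (a : R) (p : seq R) : R :=
  \big[Num.max/0]_(d <- pairmap (fun u v => `|v - u|) a p) d.

(* Q t_0 t_1 (Q t_1 t_2 (... (Q t_(n-1) t_n x))) *)
Fixpoint chain (Q : R -> R -> {linear E -> E}) (a : R) (p : seq R) (x : E) : E :=
  if p is b :: p' then Q a b (chain Q b p' x) else x.

End Defs.

(* Main.v *)
Require Import Defs.
From HB Require Import structures.
From mathcomp Require Import all_boot all_order all_algebra.
From mathcomp Require Import all_classical all_reals all_analysis.
From mathcomp Require Import ring.
Import Order.TTheory GRing.Theory Num.Theory.
Import numFieldNormedType.Exports.
Local Open Scope classical_set_scope.
Local Open Scope ring_scope.

(** The argument is that of Chernoff and Lax: stability and consistency imply
    convergence. Stability is free, since products of contractions are
    contractions; together with the boundedness of the single operator U s t it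
    reduces the claim to the vectors of the dense space Y [cvg_from_dense].

    Let x be in Y and follow its orbit f tau = U tau t x. The product of the
    Q's applied to x = f t differs from f s by the sum of the transported
    one-step errors [chain_error], and the claim follows once
    |Q (tau - h) tau (f tau) - f (tau - h)| <= e * h for all small h, uniformly
    in tau [consistency_along_orbit]. Both terms are compared with
    f tau + h * A tau (f tau).

    For f (tau - h): the left generators say that the left quotients of f
    converge to A tau (f tau), which is continuous in tau since tau |-> f tau
    is continuous for the norm of Y, A tau x is continuous in tau, and the
    operators A tau are equibounded from Y to E. A mean value inequality for
    left quotients then makes the convergence uniform [left_quotient_uniform].

    For Q: the quotients converge to A tau on each fixed vector of Y, uniformly
    in tau. By the uniform boundedness principle they are equibounded from Y to
    E [left_quotients_equibounded], so that the convergence is uniform along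
    the orbit, whose image in Y is compact [equilipschitz_near0_along_curve]. *)

(** * Left difference quotients *)

Lemma near_right0 (R : realType) (P : R -> Prop) :
  (\forall h \near 0^'+, P h) ->
  exists2 d : R, 0 < d & forall h, 0 < h -> h < d -> P h.
Proof.
rewrite /at_right near_withinE => /nbhs_ballP[d /= d0 dP].
exists d => // h h0 hd; apply: dP => //.
by rewrite /ball/= sub0r normrN gtr0_norm.
Qed.

(** A mean value inequality which needs the left difference quotients only:
    these are the only ones that the left generators control. *)
Lemma increment_bound (R : realType) (E : normedModType R) (f : R -> E)
    (c : E) (K a b : R) :
  a <= b -> {within `[a, b], continuous f} ->
  (forall t, a < t -> t <= b ->
    \forall h \near 0^'+, `|f (t - h) - f t - h *: c| <= K * h) ->
  `|f a - f b - (b - a) *: c| <= K * (b - a).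
Proof.
move=> ab fcont fleft; rewrite leNgt; apply/negP => bad_a.
(* The bad points form a set containing a; m is its supremum. *)
pose B := [set t | [/\ a <= t, t <= b & K * (b - t) < `|f t - f b - (b - t) *: c|]].
have Ba : B a by split.
have ubB : ubound B b by move=> t [].
have supB : has_sup B by split; [exists a | exists b].
set m := sup B.
have am : a <= m by apply: ub_le_sup => //; exists b.
have mb : m <= b by apply: ge_sup => //; exists a.
(* If m were bad it would be smaller than b, where equality holds, and by
   continuity points slightly to the right of m would be bad too. *)
have mNB : `|f m - f b - (b - m) *: c| <= K * (b - m).
  rewrite leNgt; apply/negP => bad_m.
  have m_lt_b : m < b.
    rewrite lt_neqAle mb andbT; apply/negP => /eqP mE.
    by move: bad_m; rewrite mE !subrr scale0r subr0 normr0 mulr0 ltxx.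
  have : (K * (b - t) - `|f t - f b - (b - t) *: c|)
      @[t --> within `[a, b] (nbhs m)] --> K * (b - m) - `|f m - f b - (b - m) *: c|.
    have fm : f t @[t --> within `[a, b] (nbhs m)] --> f m.
      by move/subspace_continuousP : fcont; apply; rewrite /= in_itv/= am mb.
    have idm : t @[t --> within `[a, b] (nbhs m)] --> m by exact: cvg_within.
    have bm : (b - t) @[t --> within `[a, b] (nbhs m)] --> b - m.
      by apply: cvgB => //; exact: cvg_cst.
    apply: cvgB; first by apply: cvgM => //; exact: cvg_cst.
    apply: cvg_norm; apply: cvgB; last by apply: cvgZl.
    by apply: cvgB => //; exact: cvg_cst.
  move=> /cvgr_lt /(_ 0); rewrite subr_lt0 => /(_ bad_m).
  rewrite near_withinE => /nbhs_ballP[r /= r0 near_m].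
  pose t := Num.min b (m + r / 2).
  have mt : m < t by rewrite lt_min m_lt_b ltrDl divr_gt0.
  have tr : t <= m + r / 2 by rewrite ge_min lexx orbT.
  have tb : t <= b by rewrite ge_min lexx.
  have Bt : B t.
    split => //; first by rewrite (le_trans am) ?ltW.
    rewrite -subr_lt0; apply: near_m; last first.
      by rewrite /= in_itv/= tb (le_trans am) ?ltW.
    rewrite /ball/= ltr0_norm ?subr_lt0// opprB ltrBlDl (le_lt_trans tr)//.
    by rewrite ltrD2l ltr_pdivrMr// ltr_pMr// ltr1n.
  by have := ub_le_sup (ex_intro _ b ubB) Bt; rewrite leNgt mt.
have a_lt_m : a < m.
  rewrite lt_neqAle am andbT; apply/negP => /eqP mE.
  by move: mNB; rewrite -mE leNgt bad_a.
(* The bound at m and the hypothesis at m add up, so no point slightly to the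
   left of m is bad, although bad points accumulate at m. *)
have [d d0 small] := near_right0 _ _ (fleft _ a_lt_m mb).
have [t Bt mdt] := sup_adherent d0 supB.
have tm : t <= m by apply: ub_le_sup => //; exists b.
have [_ _] := Bt; apply/negP; rewrite -leNgt.
move: tm; rewrite le_eqVlt => /predU1P[->//|tm].
have := small (m - t); rewrite subr_gt0 ltrBlDl -ltrBlDr => /(_ tm mdt).
rewrite subKr => step.
have -> : f t - f b - (b - t) *: c
    = (f t - f m - (m - t) *: c) + (f m - f b - (b - m) *: c).
  have -> : b - t = (m - t) + (b - m) by ring.
  by rewrite scalerDl opprD [RHS]addrACA subrKA.
have -> : K * (b - t) = K * (m - t) + K * (b - m) by ring.
by rewrite (le_trans (ler_normD _ _))// lerD.
Qed.

(** A continuous function with a continuous left derivative is continuously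
    differentiable, with uniformly convergent difference quotients: the
    increment f (t - h) - f t is compared with h *: g t, and g is uniformly
    continuous. *)
Lemma left_quotient_uniform (R : realType) (E : normedModType R)
    (f g : R -> E) (a b : R) :
  {within `[a, b], continuous f} -> {within `[a, b], continuous g} ->
  (forall t, a < t -> t <= b -> h^-1 *: (f (t - h) - f t) @[h --> 0^'+] --> g t) ->
  forall e : R, 0 < e -> \forall h \near 0^'+, forall t, a <= t - h -> t <= b ->
    `|f (t - h) - f t - h *: g t| <= e * h.
Proof.
move=> fcont gcont fg e e0.
have e20 : 0 < e / 2 by rewrite divr_gt0.
have e40 : 0 < e / 2 / 2 by rewrite divr_gt0.
(* Compactness of the interval gives the uniform continuity of g. *)
have gunif : \forall h \near 0^'+, `[a, b] `<=`
    (fun t => forall u, a <= u -> t - h <= u -> u <= t -> `|g u - g t| < e / 2).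
  have : compact `[a, b] by exact: segment_compact.
  move/compact_near_coveringP/near_covering_withinP; apply => t0 tab.
  have : \forall t \near t0, `[a, b]%classic t -> `|g t0 - g t| < e / 2 / 2.
    move/subspace_continuousP : gcont => /(_ _ tab) /cvgr_dist_lt /(_ _ e40).
    by rewrite near_withinE.
  move=> /nbhs_ballP[r /= r0 gr].
  have r20 : 0 < r / 2 by rewrite divr_gt0.
  near=> t h => tin u au thu ut.
  have uin : `[a, b]%classic u.
    rewrite /= in_itv/= au (le_trans ut)//.
    by move: tin; rewrite /= in_itv/= => /andP[].
  have tt0 : `|t0 - t| < r / 2 by near: t; exact: nbhsx_ballx.
  have hr : h < r / 2 by near: h; exact: nbhs_right_lt.
  have ut0 : `|t0 - u| < r.
    rewrite -(subrKA t) [ltRHS]splitr (le_lt_trans (ler_normD _ _))// ltrD//.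
    by rewrite ger0_norm ?subr_ge0//; rewrite (le_lt_trans _ hr)// lerBlDr -lerBlDl.
  rewrite -(subrKA (g t0)) [ltRHS]splitr (le_lt_trans (ler_normD _ _))// ltrD//.
    by rewrite distrC; exact: gr.
  by apply: gr => //; rewrite /ball/= (lt_trans tt0)// ltr_pdivrMr// ltr_pMr// ltr1n.
near=> h => t ath tb.
have h0 : 0 < h by near: h; exact: nbhs_right_gt.
have tab : `[a, b]%classic t by rewrite /= in_itv/= tb (le_trans ath)// gerBl ltW.
have gu : forall u, a <= u -> t - h <= u -> u <= t -> `|g u - g t| < e / 2.
  by move: t tab {ath tb}; near: h.
have hE : h = t - (t - h) by rewrite subKr.
rewrite {2 3}hE; apply: increment_bound.
- by rewrite gerBl ltW.
- apply: continuous_subspaceW fcont => u /=; rewrite !in_itv/= => /andP[hu ut].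
  by rewrite (le_trans ath hu) (le_trans ut tb).
move=> u thu ut; have au := le_lt_trans ath thu.
have fgu := fg u au (le_trans ut tb).
near=> k.
have k0 : 0 < k by near: k; exact: nbhs_right_gt.
have quot : `|g u - k^-1 *: (f (u - k) - f u)| < e / 2.
  by near: k; exact: cvgr_dist_lt fgu _ e20.
have -> : f (u - k) - f u - k *: g t
    = k *: (k^-1 *: (f (u - k) - f u) - g u + (g u - g t)).
  by rewrite subrKA scalerBr scalerA divff ?gt_eqF// scale1r.
rewrite normrZ gtr0_norm// mulrC ler_pM2r// [leRHS]splitr.
rewrite (le_trans (ler_normD _ _))// lerD ?ltW//; first by rewrite distrC.
by apply: gu => //; exact: ltW.
Unshelve. all: by end_near. Qed.

(** * Equi-Lipschitz families of maps *)

(** The uniform boundedness principle in terms of operator norms: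
    [Banach_Steinhauss] bounds the family on the unit ball, and homogeneity does
    the rest. *)
Lemma equibounded_linear (R : realType) (V : completeNormedModType R)
    (W : normedModType R) (F : set (V -> W)) :
  (forall f, F f -> linear f) ->
  (forall f, F f -> exists M : R, forall x, `|f x| <= M * `|x|) ->
  pointwise_bounded F ->
  exists2 M : R, 0 <= M & forall f, F f -> forall x, `|f x| <= M * `|x|.
Proof.
move=> Flin Fbnd /Banach_Steinhauss Fub.
have [|M FM] := Fub _ 1.
  move=> f Ff; split; last exact: Flin.
  move=> r; have [M fM] := Fbnd _ Ff; exists (`|M| * r) => x xr.
  rewrite (le_trans (fM x))// (le_trans _ (ler_wpM2l _ xr))//.
  by rewrite ler_wpM2r// ler_norm.
exists `|M| => // f Ff x.
have flin : linear f := Flin _ Ff.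
pose g : {linear V -> W} := HB.pack f (GRing.isLinear.Build _ _ _ _ _ flin).
have [->|x0] := eqVneq x 0.
  by rewrite (_ : f 0 = 0) ?normr0 ?mulr0//; exact: (linear0 g).
have nx0 : 0 < `|x| by rewrite normr_gt0.
rewrite -ler_pdivrMr//.
have -> : `|f x| / `|x| = `|f (`|x|^-1 *: x)|.
  have -> : f (`|x|^-1 *: x) = `|x|^-1 *: f x by exact: (linearZ_LR g).
  by rewrite normrZ gtr0_norm ?invr_gt0// mulrC.
rewrite (le_trans _ (ler_norm M))//; apply: FM => //.
by rewrite normrZ gtr0_norm ?invr_gt0// mulVf// gt_eqF.
Qed.

Lemma cvg_equilipschitz (R : realType) (V W : normedModType R) (I : Type)
    (F : set_system I) (FF : Filter F) (B : I -> V -> W) (y : I -> V) (y0 : V)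
    (l : W) (C : R) :
  (\forall i \near F, forall u v, `|B i u - B i v| <= C * `|u - v|) ->
  y i @[i --> F] --> y0 -> B i y0 @[i --> F] --> l ->
  B i (y i) @[i --> F] --> l.
Proof.
move=> Blip yy0 Bl; apply/cvgrPdist_lt => e e0.
have C0 : 0 < `|C| + 1 by rewrite ltr_wpDl.
have dy : 0 < e / 2 / (`|C| + 1) by rewrite !divr_gt0.
have e20 : 0 < e / 2 by rewrite divr_gt0.
near=> i.
have lB : `|l - B i y0| < e / 2 by near: i; exact: cvgr_dist_lt.
have yi : `|y0 - y i| < e / 2 / (`|C| + 1) by near: i; exact: cvgr_dist_lt.
have BB : `|B i y0 - B i (y i)| <= C * `|y0 - y i|.
  by move: (y0) (y i); near: i; apply: filterS Blip => i Hi u v.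
rewrite -(subrKA (B i y0)) (le_lt_trans (ler_normD _ _))// [ltRHS]splitr.
rewrite ltrD// (le_lt_trans BB)//.
move: yi; rewrite ltr_pdivlMr//; apply: le_lt_trans.
by rewrite mulrC ler_wpM2l// (le_trans (ler_norm _))// lerDl.
Unshelve. all: by end_near. Qed.

(** Strong convergence of equi-Lipschitz maps is uniform on compact sets. Here
    the vector follows a curve and the maps depend on its parameter as well;
    the predicate P restricts the pairs (index, parameter) for which the maps
    are under control, as the condition S <= t - h does below. *)
Lemma equilipschitz_near0_along_curve (R : realType) (V W : normedModType R)
    (X : topologicalType) (K : set X) (I : Type) (F : set_system I)
    (FF : Filter F) (P : I -> X -> Prop) (L : I -> X -> V -> W) (y : X -> V)
    (C : R) :
  compact K -> {within K, continuous y} ->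
  (forall i x, K x -> P i x -> forall u v, `|L i x u - L i x v| <= C * `|u - v|) ->
  (forall v (e : R), 0 < e ->
    \forall i \near F, forall x, K x -> P i x -> `|L i x v| < e) ->
  forall e : R, 0 < e ->
    \forall i \near F, forall x, K x -> P i x -> `|L i x (y x)| < e.
Proof.
move=> cptK /subspace_continuousP ycont Llip L0 e e0.
have C0 : 0 < `|C| + 1 by rewrite ltr_wpDl.
have dy : 0 < e / 2 / (`|C| + 1) by rewrite !divr_gt0.
have e20 : 0 < e / 2 by rewrite divr_gt0.
move/compact_near_coveringP/near_covering_withinP : cptK; apply => x0 Kx0.
have ynear : \forall x \near x0, K x -> `|y x0 - y x| < e / 2 / (`|C| + 1).
  by move: (ycont _ Kx0) => /cvgr_dist_lt /(_ _ dy); rewrite near_withinE.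
(* Near x0 the point y x may be replaced by y x0 at a cost of C * |y x0 - y x|,
   and at the fixed vector y x0 the smallness is known uniformly in x. *)
exists ([set x | K x -> `|y x0 - y x| < e / 2 / (`|C| + 1)],
  [set i | forall x, K x -> P i x -> `|L i x (y x0)| < e / 2]).
  by split => //; exact: L0.
move=> [x i] /= [yx Ly0] Kx Pix; move/(_ Kx): yx => yx.
have {}Ly0 := Ly0 _ Kx Pix.
rewrite -(subrK (L i x (y x0)) (L i x (y x))).
rewrite (le_lt_trans (ler_normD _ _))// [ltRHS]splitr ltrD//.
rewrite distrC (le_lt_trans (Llip _ _ Kx Pix _ _))//.
move: yx; rewrite ltr_pdivlMr//; apply: le_lt_trans.
by rewrite mulrC ler_wpM2l// (le_trans (ler_norm _))// lerDl.
Qed.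

Lemma cvg_from_dense (R : realType) (V W : normedModType R) (I : Type)
    (F : set_system I) (FF : Filter F) (B : I -> V -> W) (L : V -> W)
    (G : set V) (C : R) :
  dense G ->
  (\forall i \near F, forall u v, `|B i u - B i v| <= C * `|u - v|) ->
  (forall u v, `|L u - L v| <= C * `|u - v|) ->
  (forall y, G y -> B i y @[i --> F] --> L y) ->
  forall x, B i x @[i --> F] --> L x.
Proof.
move=> Gdense Blip Llip BL x; apply/cvgrPdist_lt => e e0.
have C0 : 0 < `|C| + 1 by rewrite ltr_wpDl.
have e30 : 0 < e / 3 by rewrite divr_gt0.
have r0 : 0 < e / 3 / (`|C| + 1) by rewrite divr_gt0.
have [y [xy Gy]] : ball x (e / 3 / (`|C| + 1)) `&` G !=set0.
  by apply: Gdense; [exists x; exact: ballxx | exact: ball_open].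
have small : C * `|x - y| < e / 3.
  move: xy; rewrite -ball_normE/= ltr_pdivlMr//; apply: le_lt_trans.
  by rewrite mulrC ler_wpM2l// (le_trans (ler_norm _))// lerDl.
near=> i.
have Bi : `|L y - B i y| < e / 3 by near: i; exact: cvgr_dist_lt (BL _ Gy) _ e30.
have BB : `|B i y - B i x| <= C * `|x - y|.
  by rewrite distrC; near: i; apply: filterS Blip => i; exact.
have -> : e = e / 3 + e / 3 + e / 3 by field.
rewrite -(subrKA (B i y)) -[X in X + _](subrKA (L y)).
rewrite (le_lt_trans (ler_normD _ _))// ltrD//; last exact: le_lt_trans BB small.
rewrite (le_lt_trans (ler_normD _ _))// ltrD//.
exact: le_lt_trans (Llip _ _) small.
Unshelve. all: by end_near. Qed.

(** * Products along a partition *)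

Lemma mesh_ge_step (R : realType) (a b : R) (p : seq R) :
  `|b - a| <= mesh a (b :: p) /\ mesh b p <= mesh a (b :: p).
Proof. by rewrite /mesh /= big_cons !le_max !lexx orbT. Qed.

(** Telescoping: the product differs from f a by the sum of the one-step errors,
    each of them transported by the contractions that precede it. *)
Lemma chain_error (R : realType) (E : completeNormedModType R) (S t e d : R)
    (Q : R -> R -> {linear E -> E}) (f : R -> E) :
  (forall u v, S <= u -> u <= v -> v <= t -> contractive (Q u v)) ->
  (forall u v, S <= u -> u < v -> v <= t -> v - u < d ->
     `|Q u v (f v) - f u| <= e * (v - u)) ->
  forall p a, S <= a -> itv_partition a t p -> mesh a p < d ->
  `|chain Q a p (f t) - f a| <= e * (t - a).
Proof.
move=> Qc step; elim=> [|b p ih] a Sa.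
  by move=> /itv_partition_nil -> _ /=; rewrite !subrr normr0 mulr0.
move=> itvp mp; have [step_d mbp] := mesh_ge_step _ a b p.
have itvb : itv_partition b t p by exact: itv_partition_cons itvp.
have bt : b <= t by exact: itv_partition_le itvb.
have ab : a < b by case: itvp => /= /andP[].
have Sb : S <= b by rewrite (le_trans Sa) ?ltW.
rewrite /= -(subrKA (Q a b (f b))) -linearB.
rewrite (le_trans (ler_normD _ _))//.
have -> : e * (t - a) = e * (t - b) + e * (b - a) by ring.
apply: lerD.
  rewrite (le_trans (Qc _ _ Sa (ltW ab) bt _))//.
  by apply: ih => //; rewrite (le_lt_trans mbp).
apply: step => //; rewrite -[ltLHS]gtr0_norm ?subr_gt0//.
by rewrite (le_lt_trans step_d).
Qed.

Lemma chain_lipschitz (R : realType) (E : completeNormedModType R) (S t : R)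
    (Q : R -> R -> {linear E -> E}) (x y : E) :
  (forall u v, S <= u -> u <= v -> v <= t -> contractive (Q u v)) ->
  forall p a, S <= a -> itv_partition a t p ->
  `|chain Q a p x - chain Q a p y| <= `|x - y|.
Proof.
move=> Qc; elim=> [//|b p ih] a Sa itvp /=.
have itvb : itv_partition b t p by exact: itv_partition_cons itvp.
have bt : b <= t by exact: itv_partition_le itvb.
have ab : a < b by case: itvp => /= /andP[].
rewrite -linearB (le_trans (Qc _ _ Sa (ltW ab) bt _))// ih//.
by rewrite (le_trans Sa) ?ltW.
Qed.

(** * Operators on the dense Banach space *)

Lemma restrE (R : realType) (E Y : completeNormedModType R) (j : Y -> E)
    (f : E -> E) (y : Y) :
  range j (f (j y)) -> j (restr j f y) = f (j y).
Proof. by move=> [z _ jz]; apply: (@getPex _ [set z | j z = f (j y)]); exists z. Qed.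

(** For t > S linearity is inherited from the difference quotients by uniqueness
    of limits; at t = S it is part of the data. *)
Lemma left_generators_sub (R : realType) (E : completeNormedModType R)
    (S T : R) (U : R -> R -> {linear E -> E}) (D : R -> set E)
    (A : R -> E -> E) (t : R) (x y : E) :
  left_generators S T U D A -> S <= t -> t <= T -> D t x -> D t y ->
  A t (x - y) = A t x - A t y.
Proof.
move=> [[_ linS] gen]; rewrite le_eqVlt => /predU1P[<- _ Dx Dy|St tT Dx Dy].
  by have [_] := linS (-1) y x Dy Dx; rewrite !scaleN1r ![- _ + _]addrC.
have [DE Alim] := gen t St tT.
have quot_sub : left_quotient U t (x - y) h @[h --> 0^'+] --> A t x - A t y.
  have -> : left_quotient U t (x - y) =
      (fun h => left_quotient U t x h - left_quotient U t y h).
    apply/funext => h; rewrite /left_quotient -scalerBr; congr (_ *: _).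
    by rewrite linearB/= !opprD !opprK addrACA.
  by apply: cvgB; exact: Alim.
have Dxy : D t (x - y) by rewrite DE /=; exact: cvgP quot_sub.
exact: (cvg_unique (@norm_hausdorff _ _) (Alim _ Dxy) quot_sub).
Qed.

(** Each `|A t (j x)| lies below the extended-real supremum, so the norm of Y
    bounds the inclusion j and all the operators A t with the constant
    1 / gamma. *)
Lemma graph_norm_bound (R : realType) (E Y : normedModType R) (S T : R)
    (A : R -> E -> E) (j : Y -> E) :
  (exists2 gamma : R, 0 < gamma & forall x : Y,
      (gamma%:E * (`|j x|%:E +
         ereal_sup [set `|A tau (j x)|%:E | tau in `[S, T]]) <= `|x|%:E)%E) ->
  S <= T ->
  exists2 C : R, 0 <= C & forall x, `|j x| <= C * `|x| /\
    forall t, S <= t -> t <= T -> `|A t (j x)| <= C * `|x|.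
Proof.
move=> [gamma gamma0 normY] ST; exists gamma^-1; first by rewrite invr_ge0 ltW.
move=> x.
have sum_le t : S <= t -> t <= T -> `|j x| + `|A t (j x)| <= gamma^-1 * `|x|.
  move=> St tT; rewrite ler_pdivlMl// -lee_fin EFinM EFinD.
  rewrite (le_trans _ (normY x))// lee_pmul2l// leeD2l// ereal_sup_ubound//.
  by exists t => //=; rewrite in_itv/= St.
split=> [|t St tT]; first by rewrite (le_trans _ (sum_le S _ _))// lerDl.
by rewrite (le_trans _ (sum_le t _ _))// lerDr.
Qed.

(** This is where the completeness of Y enters: convergence of the quotients
    on each vector of Y becomes, by the uniform boundedness principle, a bound
    on their norms as operators from Y to E. *)
Lemma left_quotients_equibounded (R : realType) (E Y : completeNormedModType R)
    (S T C : R) (A : R -> E -> E) (Q : R -> R -> {linear E -> E})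
    (j : {linear Y -> E}) :
  0 <= C -> (forall x, `|j x| <= C * `|x|) ->
  (forall x t, S <= t -> t <= T -> `|A t (j x)| <= C * `|x|) ->
  (forall t1 t2, S <= t1 -> t1 <= t2 -> t2 <= T -> contractive (Q t1 t2)) ->
  (forall x (e : R), 0 < e -> \forall h \near 0^'+, forall t, S <= t - h -> t <= T ->
     `|left_quotient Q t (j x) h - A t (j x)| < e) ->
  exists2 M : R, 0 <= M & forall h t, 0 < h -> S <= t - h -> t <= T ->
    forall x, `|left_quotient Q t (j x) h| <= M * `|x|.
Proof.
move=> C0 jC AC Qc Qlim.
have quot_le h t x : 0 < h -> S <= t - h -> t <= T ->
    `|left_quotient Q t (j x) h| <= h^-1 * (2 * (C * `|x|)).
  move=> h0 Sth tT; rewrite /left_quotient normrZ gtr0_norm ?invr_gt0//.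
  rewrite ler_pM2l ?invr_gt0// (le_trans (ler_normB _ _))// mulr2n mulrDl mul1r.
  rewrite lerD// (le_trans (Qc _ _ Sth _ tT _))// gerBl; exact: ltW.
pose F := [set f : Y -> E | exists h t, [/\ 0 < h, S <= t - h, t <= T &
  f = fun x => left_quotient Q t (j x) h]].
have [f [h [t [h0 Sth tT ->]]]|f [h [t [h0 Sth tT ->]]]|x|M M0 FM] :=
    @equibounded_linear R Y E F.
- move=> a u v; rewrite /left_quotient (linearP j) (linearP (Q _ _)) /=.
  rewrite scalerA (mulrC a) -scalerA -scalerDr; congr (_ *: _).
  by rewrite scalerBr opprD addrACA.
- by exists (h^-1 * (2 * C)) => x; rewrite -!mulrA; exact: quot_le.
- have [d d0 dQ] := near_right0 _ _ (Qlim x 1 ltr01).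
  exists (1 + C * `|x| + d^-1 * (2 * (C * `|x|))) => _ [h [t [h0 Sth tT ->]]].
  have St : S <= t by rewrite (le_trans Sth)// gerBl ltW.
  have Cx0 : 0 <= C * `|x| by rewrite mulr_ge0.
  (* Short steps are controlled by the limit A t (j x), which is bounded in t;
     for steps of length at least d the crude bound is already uniform. *)
  have [hd|dh] := ltP h d.
    rewrite -[leLHS]addr0 lerD ?mulr_ge0 ?invr_ge0 ?(ltW d0)//.
    rewrite -(subrK (A t (j x)) (left_quotient _ _ _ _)).
    by rewrite (le_trans (ler_normD _ _))// lerD ?AC// ltW// dQ.
  rewrite (le_trans (quot_le h t x h0 Sth tT))// -[leLHS]add0r lerD//.
    by rewrite addr_ge0.
  by rewrite ler_wpM2r ?mulr_ge0// lef_pV2.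
exists M => // h t h0 Sth tT x.
by apply: (FM (fun x => left_quotient Q t (j x) h)); exists h, t.
Qed.

(** * Consistency and convergence *)

(** Uniform consistency: along the curve, one step of Q reproduces the curve up
    to o(h), uniformly in time. The quotients of Q converge to A uniformly
    along the curve because its image in Y is compact, and the quotients of the
    curve converge uniformly to the same limit because tau |-> A tau (j (y tau))
    is continuous. *)
Lemma consistency_along_orbit (R : realType) (E Y : completeNormedModType R)
    (S t C M : R) (A : R -> E -> E) (Q : R -> R -> {linear E -> E})
    (j : {linear Y -> E}) (y : R -> Y) :
  (forall x, `|j x| <= C * `|x|) ->
  (forall u v tau, S <= tau -> tau <= t ->
     `|A tau (j u) - A tau (j v)| <= C * `|u - v|) ->
  (forall x, {within `[S, t], continuous (fun tau => A tau (j x))}) ->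
  (forall h tau, 0 < h -> S <= tau - h -> tau <= t ->
     forall x, `|left_quotient Q tau (j x) h| <= M * `|x|) ->
  (forall x (e : R), 0 < e ->
     \forall h \near 0^'+, forall tau, S <= tau - h -> tau <= t ->
       `|left_quotient Q tau (j x) h - A tau (j x)| < e) ->
  {within `[S, t], continuous y} ->
  (forall tau, S < tau -> tau <= t ->
     h^-1 *: (j (y (tau - h)) - j (y tau)) @[h --> 0^'+] --> A tau (j (y tau))) ->
  forall e : R, 0 < e ->
    \forall h \near 0^'+, forall tau, S <= tau - h -> tau <= t ->
      `|Q (tau - h) tau (j (y tau)) - j (y (tau - h))| <= e * h.
Proof.
move=> jC Alip Acont QM Qlim ycont yder e e0.
have e20 : 0 < e / 2 by rewrite divr_gt0.
have ycvg u : S <= u -> u <= t ->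
    y x @[x --> within `[S, t] (nbhs u)] --> y u.
  move=> Su ut; move/subspace_continuousP : ycont; apply.
  by rewrite /= in_itv/= Su.
have jycont : {within `[S, t], continuous (fun tau => j (y tau))}.
  apply/subspace_continuousP => u; rewrite /= in_itv/= => /andP[Su ut].
  apply: (@cvg_equilipschitz _ _ _ _ _ _ (fun=> j) y (y u) _ C).
  - by apply: nearW => _ v w; rewrite -linearB.
  - exact: ycvg.
  - exact: cvg_cst.
have Aycont : {within `[S, t], continuous (fun tau => A tau (j (y tau)))}.
  apply/subspace_continuousP => u; rewrite /= in_itv/= => /andP[Su ut].
  apply: (@cvg_equilipschitz _ _ _ _ _ _ (fun tau => A tau \o j) y (y u) _ C).
  - rewrite near_withinE; apply: nearW => tau; rewrite /= in_itv/= => /andP[? ?] v w.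
    exact: Alip.
  - exact: ycvg.
  - move/subspace_continuousP : (Acont (y u)); apply.
    by rewrite /= in_itv/= Su.
(* The one-step error is h times the error in the quotient of Q, minus the
   error of the linear approximation of the curve itself. *)
have U_unif := left_quotient_uniform _ _ _ _ _ _ jycont Aycont yder _ e20.
have Q_unif : \forall h \near 0^'+, forall tau, `[S, t]%classic tau ->
    0 < h /\ S <= tau - h ->
    `|left_quotient Q tau (j (y tau)) h - A tau (j (y tau))| < e / 2.
  apply: (@equilipschitz_near0_along_curve R Y E R `[S, t] R (0^'+) _
    (fun h tau => 0 < h /\ S <= tau - h)
    (fun h tau v => left_quotient Q tau (j v) h - A tau (j v)) y (M + C)) => //.
  - exact: segment_compact.
  - move=> h tau; rewrite /= in_itv/= => /andP[Stau taut] [h0 Sh] u v.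
    rewrite opprD opprK addrACA (le_trans (ler_normD _ _))// mulrDl.
    rewrite [- A _ _ + _]addrC lerD//; last by rewrite distrC; exact: Alip.
    rewrite (_ : _ - _ = left_quotient Q tau (j (u - v)) h); first exact: QM.
    rewrite /left_quotient -scalerBr (linearB j) (linearB (Q _ _)); congr (_ *: _).
    by rewrite !opprD !opprK addrACA.
  - move=> v e' e'0; near=> h => tau; rewrite /= in_itv/= => /andP[_ taut] [_ Sh].
    move: tau taut Sh; near: h.
    by apply: filterS (Qlim v e' e'0) => h H tau *; exact: H.
near=> h => tau Sh taut.
have h0 : 0 < h by near: h; exact: nbhs_right_gt.
have Stau : S <= tau by rewrite (le_trans Sh)// gerBl ltW.
have QA : `|left_quotient Q tau (j (y tau)) h - A tau (j (y tau))| < e / 2.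
  have tin : `[S, t]%classic tau by rewrite /= in_itv/= Stau.
  have hS : 0 < h /\ S <= tau - h by [].
  by move: tau tin hS {Sh taut Stau}; near: h.
have UA : `|j (y (tau - h)) - j (y tau) - h *: A tau (j (y tau))| <= e / 2 * h.
  by move: tau Sh taut {Stau QA}; near: h.
have -> : Q (tau - h) tau (j (y tau)) - j (y (tau - h)) =
    h *: (left_quotient Q tau (j (y tau)) h - A tau (j (y tau)))
    - (j (y (tau - h)) - j (y tau) - h *: A tau (j (y tau))).
  rewrite scalerBr /left_quotient scalerA divff ?gt_eqF// scale1r.
  by rewrite !opprB addrA subrK addrA subrK.
rewrite (le_trans (ler_normB _ _))// [e]splitr mulrDl lerD//.
by rewrite normrZ gtr0_norm// mulrC ler_wpM2r ?ltW.
Unshelve. all: by end_near. Qed.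

Theorem theorem1 (R : realType) (E : completeNormedModType R) (S T : R)
    (S_ge0 : 0 <= S) (S_lt_T : S < T)
    (U : R -> R -> {linear E -> E})
    (U_propagator : backward_propagator S T U)
    (D : R -> set E) (A : R -> E -> E)
    (A_generators : left_generators S T U D A)
    (Q : R -> R -> {linear E -> E})
    (Q_contr : forall t1 t2, S <= t1 -> t1 <= t2 -> t2 <= T ->
      contractive (Q t1 t2))
    (D_dense : dense (\bigcap_(t in `[S, T]) D t))
    (Y : completeNormedModType R) (j : {linear Y -> E})
    (j_inj : injective j)
    (Y_dense : dense (range j))
    (Y_sub : range j `<=` \bigcap_(t in `[S, T]) D t)
    (U_Y : forall s t, S <= s -> s < t -> t <= T ->
      U s t @` range j `<=` range j)
    (normY : exists2 gamma : R, 0 < gamma & forall x : Y,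
      (gamma%:E * (`|j x|%:E +
         ereal_sup [set `|A tau (j x)|%:E | tau in `[S, T]]) <= `|x|%:E)%E)
    (U_cont : forall (x : Y) (t : R), S <= t -> t <= T ->
      {within `[S, t], continuous (fun tau : R => restr j (U tau t) x)})
    (A_cont : forall x : Y,
      {within `[S, T], continuous (fun t : R => A t (j x))})
    (Q_lim : forall (x : Y) (eps : R), 0 < eps ->
      \forall h \near 0^'+, forall t : R, S <= t - h -> t <= T ->
        `|left_quotient Q t (j x) h - A t (j x)| < eps) :
  forall s t : R, S <= s -> s <= t -> t <= T ->
  forall p : nat -> seq R, (forall n, itv_partition s t (p n)) ->
  mesh s (p n) @[n --> \oo] --> (0 : R) ->
  forall x : E, chain Q s (p n) x @[n --> \oo] --> U s t x.
Proof.
move=> s t Ss st tT p itvp meshp.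
have [U_bnd U1 UM] := U_propagator.
have St : S <= t := le_trans Ss st.
have [C C0 jAC] := graph_norm_bound _ _ _ _ _ _ _ normY (ltW S_lt_T).
have jC x : `|j x| <= C * `|x| by have [] := jAC x.
have AC x tau : S <= tau -> tau <= T -> `|A tau (j x)| <= C * `|x|.
  by have [_] := jAC x; exact.
have jD x tau : S <= tau -> tau <= T -> D tau (j x).
  by move=> Stau tauT; apply: (Y_sub (j x)); [exists x | rewrite /= in_itv/= Stau].
have Alip u v tau : S <= tau -> tau <= t ->
    `|A tau (j u) - A tau (j v)| <= C * `|u - v|.
  move=> Stau taut; have tauT := le_trans taut tT.
  rewrite -(left_generators_sub _ _ _ _ _ _ _ _ _ _ A_generators)//; try exact: jD.
  by rewrite -linearB AC.
have Acont x : {within `[S, t], continuous (fun tau => A tau (j x))}.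
  apply: continuous_subspaceW (A_cont x) => r /=; rewrite !in_itv/= => /andP[-> rt].
  exact: le_trans rt tT.
have Qc u v : S <= u -> u <= v -> v <= t -> contractive (Q u v).
  by move=> Su uv vt; apply: Q_contr => //; exact: le_trans vt tT.
have [M _ QM] := left_quotients_equibounded _ _ _ _ _ _ _ _ _ C0 jC AC Q_contr Q_lim.
have [N UN] := U_bnd _ _ Ss st tT.
(* Both the products of contractions and the single bounded operator U s t are
   Lipschitz, so vectors of Y suffice. *)
apply: (@cvg_from_dense _ _ _ _ _ _ _ _ _ (Num.max 1 N) Y_dense).
- apply: nearW => n u v.
  rewrite (le_trans (chain_lipschitz _ _ _ _ _ _ _ Qc _ _ Ss (itvp n)))//.
  by rewrite ler_peMl// le_max lexx.
- by move=> u v; rewrite -linearB (le_trans (UN _))// ler_wpM2r// le_max lexx orbT.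
move=> _ [x _ <-].
(* Since U (tau - h) t = U (tau - h) tau U tau t, the curve y has left
   quotients that are those of U at the vector y tau of Y. *)
pose y tau := restr j (U tau t) x.
have jy tau : S <= tau -> tau <= t -> j (y tau) = U tau t (j x).
  move=> Stau; rewrite le_eqVlt => /predU1P[taut|taut]; apply: restrE.
    by rewrite taut U1//; exists x.
  by apply: (U_Y tau t) => //; exists (j x) => //; exists x.
have yder tau : S < tau -> tau <= t ->
    h^-1 *: (j (y (tau - h)) - j (y tau)) @[h --> 0^'+] --> A tau (j (y tau)).
  move=> Stau taut; have tauT := le_trans taut tT.
  have [_ /(_ _ (jD (y tau) _ (ltW Stau) tauT))] := (A_generators.2 _ Stau tauT).
  apply: cvg_trans; apply: near_eq_cvg; near=> h.
  have h0 : 0 < h by near: h; exact: nbhs_right_gt.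
  have Sh : S <= tau - h.
    by rewrite lerBrDl -lerBrDr ltW//; near: h; apply: nbhs_right_lt; rewrite subr_gt0.
  have htau : tau - h <= tau by rewrite gerBl ltW.
  rewrite /left_quotient jy ?(ltW Stau)// jy ?(le_trans htau)//.
  by rewrite (UM (tau - h) tau t).
apply/cvgrPdist_le => e e0.
(* An error e' = e / (t - S + 1) per unit of time accumulates to at most e;
   the summand 1 only keeps the denominator positive when S = t. *)
have e'0 : 0 < e / (t - S + 1) by rewrite divr_gt0// ltr_wpDl// subr_ge0.
have : \forall h \near 0^'+, forall tau, S <= tau - h -> tau <= t ->
    `|Q (tau - h) tau (j (y tau)) - j (y (tau - h))| <= e / (t - S + 1) * h.
  apply: (consistency_along_orbit _ _ _ _ _ C M A) => //.
  - by move=> h tau h0 Sh taut; apply: QM => //; exact: le_trans taut tT.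
  - move=> v eps eps0; apply: filterS (Q_lim v eps eps0) => h H tau Sh taut.
    by apply: H => //; exact: le_trans taut tT.
  - exact: U_cont.
move=> /near_right0[d d0 step].
have mesh_small : \forall n \near \oo, mesh s (p n) < d.
  by exact: cvgr_lt meshp _ d0.
near=> n.
have tx : U t t (j x) = j x by rewrite U1.
rewrite distrC -[X in chain _ _ _ X]tx -!jy//.
rewrite (le_trans (chain_error _ _ S t (e / (t - S + 1)) d _ (j \o y)
  Qc _ _ _ Ss (itvp n) _))//=.
- move=> u v Su uv vt vud.
  by have := step (v - u) _ vud v; rewrite subKr subr_gt0 => /(_ uv Su vt).
- by near: n.
- rewrite -mulrA ler_piMr ?(ltW e0)// ler_pdivrMl ?mulr1 ?ltr_wpDl ?subr_ge0//.
  by rewrite (le_trans (lerB (lexx t) Ss))// lerDl.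
Unshelve. all: by end_near. Qed.
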